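(* Let $n,p,k\ge1$ be integers and let $X=(x_{ij})$ be a complex $n\times p$ random matrix which has the same distribution as $UXV$ for any unitary matrices $U$ (of size $n\times n$) and $V$ (of size $p\times p$). For any four sequences $\mathbf{i}=(i_1,\dots,i_k)$, $\mathbf{i}'=(i_1',\dots,i_k')$ in $\{1,\dots,n\}$ and $\mathbf{j}=(j_1,\dots,j_k)$, $\mathbf{j}'=(j_1',\dots,j_k')$ in $\{1,\dots,p\}$, $$E[x_{i_1j_1}\cdots x_{i_kj_k}\overline{x_{i_1'j_1'}\cdots x_{i_k'j_k'}}]=\sum_{\sigma_1,\sigma_2,\pi\in S_k}\delta_{\sigma_1}(\mathbf{i},\mathbf{i}')\,\delta_{\sigma_2}(\mathbf{j},\mathbf{j}')\,\mathrm{Wg}^{\mathrm U}(\pi\sigma_1^{-1}\sigma_2;n,p)\,E[\mathrm{Tr}_\pi(XX^* )].$$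
   Context: $S_k$ is the symmetric group on $\{1,\dots,k\}$. For $\pi\in S_k$, $\kappa(\pi)$ is the number of cycles of $\pi$ (fixed points included), and the cycle-type of $\pi$ is the partition $\mu=(\mu_1,\dots,\mu_l)$ of $k$ formed by its cycle lengths in weakly decreasing order. For sequences $\mathbf{i}=(i_1,\dots,i_k)$, $\mathbf{i}'=(i_1',\dots,i_k')$ and $\pi\in S_k$, put $\delta_\pi(\mathbf{i},\mathbf{i}')=\prod_{s=1}^k\delta_{i_{\pi(s)},i'_s}$ (Kronecker deltas). For a square matrix $A$ and $\pi\in S_k$ of cycle-type $(\mu_1,\dots,\mu_l)$, put $\mathrm{Tr}_\pi(A)=\prod_{j=1}^l\mathrm{Tr}(A^{\mu_j})$. Functions on $S_k$ are multiplied by convolution $(f_1*f_2)(\pi)=\sum_{\tau\in S_k}f_1(\tau)f_2(\tau^{-1}\pi)$. For $z\in\mathbb{C}$, the unitary Weingarten function $\mathrm{Wg}^{\mathrm U}(\cdot;z)$ on $S_k$ is the pseudo-inverse of the central function $z^{\kappa(\cdot)}:\pi\mapsto z^{\kappa(\pi)}$, i.e. the unique class function satisfying $z^{\kappa(\cdot)}*\mathrm{Wg}^{\mathrm U}(\cdot;z)*z^{\kappa(\cdot)}=z^{\kappa(\cdot)}$ and $\mathrm{Wg}^{\mathrm U}(\cdot;z)*z^{\kappa(\cdot)}*\mathrm{Wg}^{\mathrm U}(\cdot;z)=\mathrm{Wg}^{\mathrm U}(\cdot;z)$. The double-parameter version is, for $z,w\in\mathbb{C}$, $\mathrm{Wg}^{\mathrm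 U}(\cdot;z,w)=\mathrm{Wg}^{\mathrm U}(\cdot;z)*\mathrm{Wg}^{\mathrm U}(\cdot;w)$. Explicitly, $$\mathrm{Wg}^{\mathrm U}(\cdot;z)=\frac1{k!}\sum_{\lambda\vdash k,\ C_\lambda(z)\ne0}\frac{f^\lambda}{C_\lambda(z)}\chi^\lambda,\qquad \mathrm{Wg}^{\mathrm U}(\cdot;z,w)=\frac1{k!}\sum_{\lambda\vdash k,\ C_\lambda(z)C_\lambda(w)\ne0}\frac{f^\lambda}{C_\lambda(z)C_\lambda(w)}\chi^\lambda,$$ where $C_\lambda(z)=\prod_{i=1}^{\ell(\lambda)}\prod_{j=1}^{\lambda_i}(z+j-i)$, $\chi^\lambda$ is the irreducible character of $S_k$ indexed by the partition $\lambda$ of $k$, $\ell(\lambda)$ is the length of $\lambda$, and $f^\lambda=\chi^\lambda(e)$ with $e$ the identity permutation. *)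

(* Defs.v *)
From HB Require Import structures.
From mathcomp Require Import all_boot all_order all_algebra all_fingroup.
From mathcomp Require Import spectral sesquilinear complex.
From mathcomp Require Import all_classical all_reals all_analysis.

Set Implicit Arguments.
Unset Strict Implicit.
Unset Printing Implicit Defensive.

Import Order.TTheory GRing.Theory Num.Theory.

Local Open Scope classical_set_scope.
Local Open Scope ring_scope.
Local Open Scope complex_scope.

Section Permutations.
Variable k : nat.
Implicit Types pi sigma tau : 'S_k.

(* [s * t] in MathComp applies s first, whereas the product of permutations is
   meant here as composition of functions: (s \oS t)(i) = s(t(i)). *)
Definition perm_comp sigma tau : 'S_k := (tau * sigma)%g.

Definition cycle_type pi : seq nat :=
  sort geq [seq #|(c : {set 'I_k})| | c <- enum (porbits pi)].

Definition kappa pi : nat := #|porbits pi|.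

Definition delta_perm (F : pzRingType) (N : nat) pi (i i' : 'I_N ^ k) : F :=
  \prod_(s < k) (i (pi s) == i' s)%:R.

Definition Tr_perm (F : pzRingType) (N : nat) pi (A : 'M[F]_N) : F :=
  \prod_(m <- cycle_type pi) \tr (A ^+ m).

End Permutations.

Notation "s \oS t" := (perm_comp s t) (at level 40, left associativity).

Section Weingarten.
Variables (F : fieldType) (k : nat).
Implicit Types f g : {ffun 'S_k -> F}.

Definition convol f g : {ffun 'S_k -> F} :=
  [ffun pi => \sum_(tau : 'S_k) f tau * g ((tau^-1)%g \oS pi)].

Definition class_function f : Prop :=
  forall pi tau : 'S_k, f (pi ^ tau)%g = f pi.

Definition pow_kappa (z : F) : {ffun 'S_k -> F} :=
  [ffun pi => z ^+ kappa pi].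

Definition is_WgU (z : F) f : Prop :=
  [/\ class_function f,
      convol (convol (pow_kappa z) f) (pow_kappa z) = pow_kappa z &
      convol (convol f (pow_kappa z)) f = f].

(* Over the complex numbers [is_WgU z] has exactly one solution for every z,
   so the default value 0 of [xget] is never used. *)
Definition WgU (z : F) : {ffun 'S_k -> F} := xget 0 [set f | is_WgU z f].

Definition WgU2 (z w : F) : {ffun 'S_k -> F} := convol (WgU z) (WgU w).

End Weingarten.

Section RandomMatrices.
Context {d : measure_display} {T : measurableType d} {R : realType}.
Variable P : probability T R.

Definition complex_integrable (Z : T -> R[i]) : Prop :=
  P.-integrable setT (fun t => (complex.Re (Z t))%:E) /\
  P.-integrable setT (fun t => (complex.Im (Z t))%:E).

Definition complex_expectation (Z : T -> R[i]) : R[i] :=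
  fine ('E_P[fun t => complex.Re (Z t)])%E
  +i* fine ('E_P[fun t => complex.Im (Z t)])%E.

Variables n p : nat.

(* The Borel sigma-algebra of complex n x p matrices, i.e. that of R^(2np),
   generated by the real and imaginary parts of the entries. *)
Definition mx_borel : set (set 'M[R[i]]_(n, p)) :=
  <<s [set A | exists (i : 'I_n) (j : 'I_p) (B : set R), measurable B /\
        (A = [set M : 'M[R[i]]_(n, p) | B (complex.Re (M i j))] \/
         A = [set M : 'M[R[i]]_(n, p) | B (complex.Im (M i j))])] >>.

Definition random_matrix (X : T -> 'M[R[i]]_(n, p)) : Prop :=
  forall A, mx_borel A -> measurable (X @^-1` A).

Definition same_distribution (X Y : T -> 'M[R[i]]_(n, p)) : Prop :=
  forall A, mx_borel A -> P (X @^-1` A) = P (Y @^-1` A).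

End RandomMatrices.

(* Main.v *)
(* Write the moment as a tensor M(i, i', j, j').  Invariance of X under left
   multiplication by U says that, for fixed j and j', the matrix M(., ., j, j')
   commutes with the k-th tensor power of every unitary matrix U.  Diagonalizing
   Hermitian matrices and polarizing, it commutes with every matrix which is
   invariant under simultaneous permutation of the k tensor positions.  This
   applies to the kernel
     K(i, i'; a, b) = sum_(s, t) delta_s(a, b) delta_t(i, i') Wg(s^-1 t),
   seen as a matrix in (i, a), and sum_b K(i, i'; b, b) is the identity matrix by
   the pseudo-inverse property of Wg, so that
     M(i, i', j, j') = sum_(a, b) K(i, i'; a, b) M(a, b, j, j'),
   without any integration over the unitary group.  Doing the same in (j, j') and
   summing over a, b turns the moments into expectations of Tr_pi(X X^* ). *)
Require Import Defs.
From HB Require Import structures.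
From mathcomp Require Import all_boot all_order all_algebra all_fingroup.
From mathcomp Require Import spectral sesquilinear complex.
From mathcomp Require Import all_classical all_reals all_analysis.
From mathcomp Require Import measurable_realfun ring.

Set Implicit Arguments.
Unset Strict Implicit.
Unset Printing Implicit Defensive.

Import Order.TTheory GRing.Theory Num.Theory.

Local Open Scope ring_scope.
Local Open Scope sesquilinear_scope.

(** * Traces of powers along the cycles of a permutation *)

Section CycleSums.
Variables (F : comNzRingType) (N : nat) (A : 'M[F]_N).

Lemma big_tuple_cons (m : nat) (f : m.+1.-tuple 'I_N -> F) :
  \sum_(g : m.+1.-tuple 'I_N) f g =
  \sum_(z : 'I_N) \sum_(g : m.-tuple 'I_N) f [tuple of z :: g].
Proof.
rewrite pair_big /=.
rewrite (reindex (fun q : 'I_N * m.-tuple 'I_N => [tuple of q.1 :: q.2])) //=.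
exists (fun g => (thead g, behead_tuple g)) => [[z g] _|g _] /=.
  by congr pair; apply: val_inj.
by rewrite [RHS]tuple_eta; apply: val_inj.
Qed.

(** Expansion of a power over the walks from [x] to [y]: [g] lists the [m] interior vertices, and
    the default [y] of [nth], reached at index [m], supplies the endpoint. *)
Lemma mx_exp_walk m x y :
  (A ^+ m.+1) x y =
  \sum_(g : m.-tuple 'I_N) \prod_(t < m.+1) A (nth y (x :: g) t) (nth y g t).
Proof.
elim: m x => [|m IH] x.
  rewrite (bigD1 [tuple]) //= [X in _ + X]big1 => [|g]; last first.
    by case/eqP; exact: tuple0.
  by rewrite big_ord1 addr0.
rewrite exprS mxE big_tuple_cons; apply: eq_bigr => z _.
rewrite IH mulr_sumr; apply: eq_bigr => g _.
by rewrite [RHS]big_ord_recl.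
Qed.

Lemma trace_exp_walk (x0 : 'I_N) m :
  \tr (A ^+ m.+1) =
  \sum_(g : m.+1.-tuple 'I_N)
    \prod_(t < m.+1) A (nth x0 g t) (nth x0 g (t.+1 %% m.+1)).
Proof.
rewrite big_tuple_cons; apply: eq_bigr => x _.
rewrite mx_exp_walk; apply: eq_bigr => g _; apply: eq_bigr => t _ /=.
congr (A _ _); first by apply: set_nth_default; rewrite /= size_tuple.
have := ltn_ord t; rewrite ltnS leq_eqVlt orbC => /orP[ltm|/eqP eqm].
  by rewrite modn_small ?ltnS //=; apply: set_nth_default; rewrite size_tuple.
by rewrite eqm modnn /= nth_default // size_tuple.
Qed.

Variable k : nat.
Implicit Type pi : 'S_k.

(** Reading [b] along [x], [pi x], [pi (pi x)], ... turns a function on the orbit into a closed walk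
    whose length is the size of the orbit. Functions on the orbit are encoded as functions on ['I_k]
    with value [x0] elsewhere. *)
Lemma sum_orbit (x0 : 'I_N) pi (x : 'I_k) :
  \sum_(b : {ffun 'I_k -> 'I_N} | b \in pffun_on x0 (porbit pi x) predT)
     \prod_(s in porbit pi x) A (b s) (b (pi s)) = \tr (A ^+ #|porbit pi x|).
Proof.
set c := porbit pi x.
have [m cE] : exists m, #|c| = m.+1.
  by exists #|c|.-1; rewrite prednK //; apply/card_gt0P; exists x; apply: porbit_id.
set tr := traject pi x m.+1.
have ctr : c =i tr by move=> y; rewrite /c porbit_traject -/c cE.
have utr : uniq tr by rewrite /tr -cE uniq_traject_porbit.
have str : size tr = m.+1 by rewrite size_traject.
(* Outside the orbit [index] returns the length of [tr], so [nth] falls back on [x0], as [pffun_on]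
   demands. *)
pose h (g : m.+1.-tuple 'I_N) : {ffun 'I_k -> 'I_N} :=
  [ffun s => nth x0 g (index s tr)].
pose h' (b : {ffun 'I_k -> 'I_N}) : m.+1.-tuple 'I_N :=
  [tuple b (nth x tr t) | t < m.+1].
rewrite cE (trace_exp_walk x0) (reindex_onto h h') /=; last first.
  move=> b /pffun_onP[/fintype.subsetP sb _]; apply/ffunP=> s; rewrite ffunE.
  case: (boolP (s \in tr)) => sc.
    have si : (index s tr < m.+1)%N by rewrite -str index_mem.
    have -> : index s tr = Ordinal si by [].
    by rewrite -tnth_nth tnth_mktuple /= nth_index.
  rewrite nth_default; last by rewrite size_tuple -str memNindex.
  by apply/esym/eqP; apply: contraNT sc => sb'; rewrite -ctr; apply: sb.
have hh' g : h' (h g) = g.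
  apply: eq_from_tnth => t; rewrite tnth_mktuple ffunE index_uniq ?str //.
  by rewrite -tnth_nth.
apply: eq_big => [g|g _].
  rewrite hh' eqxx andbT; apply/pffun_onP; split=> //.
  apply/fintype.subsetP => s; rewrite inE ffunE ctr; apply: contraR => sc.
  by rewrite nth_default // size_tuple -str memNindex.
have -> : \prod_(s in c) A ((h g) s) ((h g) (pi s)) =
  \prod_(s <- tr) A ((h g) s) ((h g) (pi s)).
  rewrite big_uniq //=; apply: eq_bigl => s; exact: ctr.
rewrite (big_nth x) str big_mkord; apply: eq_bigr => t _.
have nE u : (u < m.+1)%N -> nth x tr u = iter u pi x.
  by move=> um; rewrite nth_traject.
rewrite !ffunE index_uniq ?str //; congr (A _ _); congr nth.
rewrite nE // -iterS.
have := ltn_ord t; rewrite ltnS leq_eqVlt orbC => /orP[ltm|/eqP eqm].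
  by rewrite modn_small ?ltnS // -nE ?ltnS // index_uniq ?str // ltnS.
by rewrite eqm modnn -cE iter_porbit /tr /= eqxx.
Qed.

(** A function on ['I_k] amounts to one function on each cycle, and the product splits along the
    cycles because [pi] preserves them; distributivity then factors the sum. *)
Lemma sum_prod_perm_orbits (x0 : 'I_N) (pi : 'S_k) :
  \sum_(a : {ffun 'I_k -> 'I_N}) \prod_(s < k) A (a s) (a (pi s)) =
  \prod_(c in porbits pi)
    \sum_(b : {ffun 'I_k -> 'I_N} | b \in pffun_on x0 c predT)
       \prod_(s in c) A (b s) (b (pi s)).
Proof.
pose b0 : {ffun 'I_k -> 'I_N} := [ffun=> x0].
rewrite (big_distr_big_dep b0) /=.
pose h (a : {ffun 'I_k -> 'I_N}) : {ffun {set 'I_k} -> {ffun 'I_k -> 'I_N}} :=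
  [ffun c => if c \in porbits pi then [ffun s => if s \in c then a s else x0]
             else b0].
pose h' (f : {ffun {set 'I_k} -> {ffun 'I_k -> 'I_N}}) : {ffun 'I_k -> 'I_N} :=
  [ffun s => f (porbit pi s) s].
have porbit_in s : porbit pi s \in porbits pi by apply/imsetP; exists s.
have mem_porbits c s : c \in porbits pi -> (s \in c) = (porbit pi s == c).
  by case/imsetP=> x _ ->; rewrite eq_porbit_mem porbit_sym.
rewrite [RHS](reindex_onto h h') /=; last first.
  move=> f /pfamilyP[/fintype.subsetP sf Hf]; apply/ffunP=> c; rewrite ffunE.
  case: ifPn => [cp|cp]; last first.
    by apply/esym/eqP; apply: contraNT cp => cf; apply: sf.
  apply/ffunP=> s; rewrite ffunE; case: ifPn => sc.
    by rewrite ffunE; move: sc; rewrite mem_porbits // => /eqP->.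
  have /pffun_onP[/fintype.subsetP sfc _] := Hf _ cp.
  by apply/esym/eqP; apply: contraNT sc => sc'; apply: sfc.
apply: eq_big => [a|a _].
  apply/esym/andP; split.
    apply/pfamilyP; split.
      apply/fintype.subsetP => c; rewrite inE ffunE.
      by case: ifP => //; rewrite eqxx.
    move=> c cp; rewrite ffunE cp; apply/pffun_onP; split=> //.
    apply/fintype.subsetP => s; rewrite inE ffunE.
    by case: ifP => //; rewrite eqxx.
  by apply/eqP/ffunP => s; rewrite !ffunE porbit_in ffunE porbit_id.
rewrite (partition_big (porbit pi) (mem (porbits pi))) /=; last first.
  by move=> s _; apply: porbit_in.
apply: eq_bigr => c cp; apply: eq_big => [s|s /eqP sc].
  by rewrite mem_porbits.
rewrite ffunE cp !ffunE.
have -> : s \in c by rewrite mem_porbits // sc.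
by have -> : pi s \in c by rewrite mem_porbits // -sc eq_porbit_mem -{1}(expg1 pi) mem_porbit.
Qed.

Lemma sum_prod_perm (x0 : 'I_N) (pi : 'S_k) :
  \sum_(a : {ffun 'I_k -> 'I_N}) \prod_(s < k) A (a s) (a (pi s)) =
  Tr_perm pi A.
Proof.
rewrite (sum_prod_perm_orbits x0) /Tr_perm /cycle_type.
rewrite (perm_big _ (permEl (perm_sort _ _))) /= big_map big_enum /=.
by apply: eq_bigr => c /imsetP[x _ ->]; apply: sum_orbit.
Qed.

End CycleSums.

(** * The Weingarten function *)

Lemma prod_natr_bool (F : comNzRingType) (I : finType) (b : I -> bool) :
  \prod_(s : I) ((b s)%:R : F) = [forall s, b s]%:R.
Proof.
case: (boolP [forall s, b s]) => [/forallP ab|/forallPn [s /negPf ns]].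
  by rewrite big1 // => s _; rewrite ab.
by rewrite (bigD1 s) //= ns mul0r.
Qed.

Lemma delta_permE (F : comNzRingType) (N k : nat) (pi : 'S_k)
    (i i' : {ffun 'I_k -> 'I_N}) :
  delta_perm F pi i i' = ([ffun s => i (pi s)] == i')%:R.
Proof.
rewrite /delta_perm prod_natr_bool; congr (_%:R); congr nat_of_bool.
apply/forallP/eqP => [e|<- s]; last by rewrite ffunE.
by apply/ffunP => s; rewrite ffunE; apply/eqP.
Qed.

Section Convolution.
Variables (F : fieldType) (k : nat).
Implicit Types (f g h : {ffun 'S_k -> F}) (pi sigma tau : 'S_k).

Lemma convolE f g pi :
  convol f g pi = \sum_(tau : 'S_k) f tau * g (pi * tau^-1)%g.
Proof. by rewrite ffunE. Qed.

Lemma convolA f g h : convol f (convol g h) = convol (convol f g) h.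
Proof.
apply/ffunP => pi; rewrite !convolE.
under eq_bigr => sigma _ do rewrite convolE mulr_sumr.
under [RHS]eq_bigr => tau _ do rewrite convolE mulr_suml.
rewrite [RHS]exchange_big /=; apply: eq_bigr => sigma _.
rewrite [RHS](reindex_inj (mulIg sigma)) /=; apply: eq_bigr => rho _.
by rewrite mulgK invMg mulgA mulrA.
Qed.

Lemma convolC f g : class_function f -> convol f g = convol g f.
Proof.
move=> cf; apply/ffunP => pi; rewrite !convolE.
have inj : injective (fun rho : 'S_k => rho^-1 * pi)%g.
  by move=> x y /mulIg /invg_inj.
rewrite (reindex_inj inj) /=; apply: eq_bigr => rho _.
rewrite invMg invgK mulKVg mulrC; congr (_ * _).
by rewrite -(cf (pi * rho^-1)%g pi) conjgE !mulgA mulVg mul1g.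
Qed.

Lemma class_convol f g :
  class_function f -> class_function g -> class_function (convol f g).
Proof.
move=> cf cg pi tau; rewrite !convolE (reindex_inj (conjg_inj tau)) /=.
by apply: eq_bigr => rho _; rewrite -conjVg -conjMg cf cg.
Qed.

Definition invf f : {ffun 'S_k -> F} := [ffun pi => f pi^-1%g].

Lemma convol_invf f g : invf (convol f g) = convol (invf g) (invf f).
Proof.
apply/ffunP => pi; rewrite ffunE !convolE.
rewrite (reindex_inj (mulIg pi^-1)%g) /=; apply: eq_bigr => rho _.
by rewrite !ffunE !invMg !invgK mulKg mulrC.
Qed.

(** Averaging over conjugates commutes with convolution by a class function. This allows a solution
    of a convolution equation to be replaced by a central one. *)
Lemma convol_average g f : class_function g ->
  convol [ffun pi => \sum_(t : 'S_k) f (pi ^ t)%g] g =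
  [ffun pi => \sum_(t : 'S_k) convol f g (pi ^ t)%g].
Proof.
move=> cg; apply/ffunP => pi; rewrite convolE ffunE.
under eq_bigr => tau _ do rewrite ffunE mulr_suml.
rewrite exchange_big /=; apply: eq_bigr => t _.
rewrite convolE [RHS](reindex_inj (conjg_inj t)) /=.
by apply: eq_bigr => rho _; rewrite -conjVg -conjMg cg.
Qed.

Lemma class_average f :
  class_function [ffun pi => \sum_(t : 'S_k) f (pi ^ t)%g].
Proof.
move=> pi tau; rewrite !ffunE [RHS](reindex_inj (mulgI tau)) /=.
by apply: eq_bigr => t _; rewrite conjgM.
Qed.

(** Class functions commute under convolution, so this is the group inverse of commutative algebra:
    if [G = y G^2], then [G y^2] is a pseudo-inverse of [G]. *)
Lemma is_WgU_of_sq (z : F) y :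
  class_function (pow_kappa k z) -> class_function y ->
  pow_kappa k z = convol y (convol (pow_kappa k z) (pow_kappa k z)) ->
  is_WgU z (convol (pow_kappa k z) (convol y y)).
Proof.
set G := pow_kappa k z => cG cy yGG.
set S := convol y y.
have GS : convol G S = convol S G := convolC _ cG.
have SGG : convol S (convol G G) = convol y G by rewrite -convolA -yGG.
have cS : class_function S by apply: class_convol.
clearbody S; split; first exact: class_convol.
- rewrite -/G GS (convolC _ cG) -!convolA (convolA G) (convolA S) SGG.
  by rewrite -convolA -yGG.
- have -> : convol (convol G S) G = convol y G by rewrite GS -convolA SGG.
  by rewrite -convolA (convolA G) (convolA y) -yGG.
Qed.

End Convolution.

(** If [u = w M] and [u M = 0], then the squared norm of [u] is [u M^t* w^t* = u M w^t* = 0]. So the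
    row space of [M] meets its kernel trivially, and [M] and [M *m M] have equal rank. *)
Lemma hermitian_sq_rank (C : numClosedFieldType) m (M : 'M[C]_m) :
  M ^t* = M -> (M <= M *m M)%MS.
Proof.
move=> hM.
have kM : \rank (M :&: kermx M)%MS = 0%N.
  apply/eqP; rewrite mxrank_eq0 -submx0; apply/rV_subP => u.
  rewrite sub_capmx => /andP[/submxP[w uE] /sub_kermxP uM].
  suff u0 : dotmx u u = 0 by rewrite submx0 -(dnorm_eq0 (@dotmx C m)); apply/eqP.
  by rewrite dotmxE {2}uE trmx_mul map_mxM /= mulmxA hM uM mul0mx mxE.
have sMM : (M *m M <= M)%MS by apply: submxMl.
rewrite -(mxrank_leqif_sup sMM).
by have := mxrank_mul_ker M M; rewrite kM addn0 => ->.
Qed.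

Lemma Tr_perm_class (F : comNzRingType) (N k : nat) (x0 : 'I_N) (A : 'M[F]_N)
    (pi t : 'S_k) : Tr_perm (pi ^ t)%g A = Tr_perm pi A.
Proof.
rewrite -!(sum_prod_perm _ x0).
have inj : injective (fun a : {ffun 'I_k -> 'I_N} => [ffun s => a (t s)]).
  move=> a b /ffunP ab; apply/ffunP => s.
  by have := ab (t^-1 s)%g; rewrite !ffunE permKV.
rewrite [RHS](reindex_inj inj) /=; apply: eq_bigr => a _.
rewrite (reindex_inj (perm_inj (s := t))) /=; apply: eq_bigr => s _.
by rewrite !ffunE conjgE !permM permK.
Qed.

Section Weingarten.
Variables (C : numClosedFieldType) (N k : nat) (x0 : 'I_N).
Implicit Types (f g h : {ffun 'S_k -> C}) (pi sigma tau : 'S_k).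

Local Notation G := (pow_kappa k (N%:R : C)).
Local Notation I := {ffun 'I_k -> 'I_N}.

Lemma pow_kappa_Tr pi : G pi = Tr_perm pi (1%:M : 'M[C]_N).
Proof.
rewrite ffunE /kappa /Tr_perm /cycle_type.
rewrite (perm_big _ (permEl (perm_sort _ _))) /= big_map big_enum /=.
rewrite (eq_bigr (fun=> N%:R)) ?prodr_const //.
by move=> c _; rewrite (expr1n 'M[C]_N) mxtrace1.
Qed.

Lemma pow_kappaE pi :
  G pi = \sum_(a : I) \prod_(s < k) (a s == a (pi s))%:R.
Proof.
rewrite pow_kappa_Tr -(sum_prod_perm _ x0); apply: eq_bigr => a _.
by apply: eq_bigr => s _; rewrite mxE.
Qed.

Lemma class_pow_kappa : class_function G.
Proof. by move=> pi t; rewrite !pow_kappa_Tr Tr_perm_class. Qed.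

Lemma pow_kappaV pi : G pi^-1%g = G pi.
Proof. by rewrite !ffunE /kappa porbitsV. Qed.

Lemma WgU_exists : exists f : {ffun 'S_k -> C}, is_WgU (N%:R : C) f.
Proof.
pose e : 'I_#|'S_k| -> 'S_k := enum_val.
pose M : 'M[C]_#|'S_k| := \matrix_(u, v) G (e v * (e u)^-1)%g.
have sumE (h : 'S_k -> C) : \sum_(u < #|'S_k|) h (e u) = \sum_(s : 'S_k) h s.
  rewrite [RHS](reindex e) //.
  by exists enum_rank => x _; [apply: enum_valK | apply: enum_rankK].
have hM : M ^t* = M.
  apply/matrixP => u v; rewrite !mxE -pow_kappaV invMg invgK ffunE.
  by rewrite rmorphXn /= conjC_nat.
(* Convolution by [G] is a real symmetric operator, so it has the same image as
   its square; hence [G] is a multiple of [G * G]. *)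
have /submxP[D MD] := hermitian_sq_rank hM.
(* The row of [M] at the identity permutation is [G] itself, and right multiplication by [M] is
   right convolution by [G]; so this row of [D] solves [y G G = G]. *)
pose u1 : 'I_#|'S_k| := enum_rank (1%g : 'S_k).
pose y : {ffun 'S_k -> C} := [ffun s => D u1 (enum_rank s)].
have yE v : y (e v) = D u1 v by rewrite /y ffunE /e enum_valK.
have yGG : convol y (convol G G) = G.
  apply/ffunP => pi.
  have -> : G pi = (D *m (M *m M)) u1 (enum_rank pi).
    by rewrite -MD mxE /e !enum_rankK invg1 mulg1.
  rewrite mulmxA convolA mxE convolE -sumE; apply: eq_bigr => v _.
  rewrite [M v _]mxE /e enum_rankK; congr (_ * _).
  rewrite convolE -sumE mxE; apply: eq_bigr => w _.
  by rewrite yE mxE.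
(* The mean of [y] over conjugation is central and still solves the equation, since [G] is
   central. *)
pose y' : {ffun 'S_k -> C} :=
  [ffun pi => (k`!)%:R^-1 * \sum_(t : 'S_k) y (pi ^ t)%g].
have cG := class_pow_kappa.
have k0 : (k`!)%:R != 0 :> C by rewrite pnatr_eq0 -lt0n fact_gt0.
have y'GG : convol y' (convol G G) = G.
  apply/ffunP => pi; rewrite convolE.
  under eq_bigr => tau _ do rewrite ffunE -mulrA.
  rewrite -mulr_sumr.
  have := congr1 (fun h : {ffun 'S_k -> C} => h pi)
    (convol_average y (class_convol cG cG)).
  rewrite convolE [in RHS]ffunE yGG.
  under eq_bigr => tau _ do rewrite ffunE.
  move=> ->; rewrite (eq_bigr (fun=> G pi)) => [|t _]; last by rewrite cG.
  by rewrite sumr_const card_Sn -[G pi *+ _]mulr_natl mulKf.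
have cy' : class_function y'.
  move=> pi t; rewrite ffunE [RHS]ffunE.
  by have := class_average y pi t; rewrite !ffunE => ->.
by exists (convol G (convol y' y')); apply: is_WgU_of_sq.
Qed.

Lemma WgUP : is_WgU (N%:R : C) (WgU k (N%:R : C)).
Proof. by have [f fP] := WgU_exists; rewrite /WgU; apply: xgetI fP. Qed.

(** The Gram matrix of the permutation operators for the Hilbert-Schmidt product: both deltas are
    nonzero only if [i] is constant on the cycles of the quotient of [sigma] and [tau]. *)
Lemma sum_delta_perm2 tau sigma :
  \sum_(i : I) \sum_(i' : I) delta_perm C tau i i' * delta_perm C sigma i i' =
  G (sigma * tau^-1)%g.
Proof.
have -> : (sigma * tau^-1 = (tau^-1 * sigma) ^ (tau^-1))%g.
  by rewrite conjgE invgK !mulgA mulgV mul1g.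
rewrite class_pow_kappa pow_kappaE; apply: eq_bigr => i _.
under eq_bigr => i' _ do rewrite !delta_permE.
rewrite (bigD1 [ffun s => i (tau s)]) //= eqxx mul1r big1 ?addr0; last first.
  by move=> i' /negPf ni; rewrite eq_sym ni mul0r.
rewrite prod_natr_bool; congr (_%:R); congr nat_of_bool.
apply/eqP/forallP => [/ffunP e s|e].
  by have := e (tau^-1 s)%g; rewrite !ffunE permKV permM => <-.
by apply/ffunP => s; rewrite !ffunE; have := e (tau s); rewrite permM permK => /eqP.
Qed.

(** By the Gram matrix, the squared Hilbert-Schmidt norm of the operator [Phi] is the sum over
    [sigma] of [(h sigma)^* * convol h G sigma], which vanishes. *)
Lemma sum_delta_perm_eq0 h : convol h G = 0 ->
  forall i i' : I, \sum_tau h tau * delta_perm C tau i i' = 0.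
Proof.
move=> hG0.
pose Phi (i i' : I) := \sum_tau h tau * delta_perm C tau i i'.
have sum0 : \sum_(i : I) \sum_(i' : I) `|Phi i i'| ^+ 2 = 0.
  transitivity (\sum_(i : I) \sum_(i' : I) \sum_sigma \sum_tau
      (h sigma)^* * h tau * (delta_perm C tau i i' * delta_perm C sigma i i')).
    apply: eq_bigr => i _; apply: eq_bigr => i' _.
    rewrite normCK /Phi rmorph_sum /= mulr_sumr; apply: eq_bigr => sigma _.
    rewrite mulr_suml; apply: eq_bigr => tau _.
    by rewrite !delta_permE rmorphM /= conjC_nat mulrACA [h tau * _]mulrC.
  under eq_bigr => i _ do rewrite exchange_big /=.
  rewrite exchange_big /= big1 // => sigma _.
  under eq_bigr => i _ do rewrite exchange_big /=.
  rewrite exchange_big /=.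
  transitivity ((h sigma)^* * convol h G sigma); last by rewrite hG0 ffunE mulr0.
  rewrite convolE mulr_sumr; apply: eq_bigr => tau _.
  rewrite -sum_delta_perm2 mulrA mulr_sumr; apply: eq_bigr => i _.
  by rewrite mulr_sumr.
move=> i i'; apply/eqP; rewrite -normr_eq0 -sqrf_eq0.
have sq0 j j' : 0 <= `|Phi j j'| ^+ 2 by rewrite exprn_ge0.
have /psumr_eq0P : \sum_(i' : I) `|Phi i i'| ^+ 2 = 0.
  by apply: (psumr_eq0P _ sum0) => // j _; apply: sumr_ge0.
by move=> -> //.
Qed.

(** For [f] the Weingarten function, this is the value given by the Weingarten formula to the Haar
    integral of the product of the entries [U (i s) (a s)] and the conjugates of
    [U (i' s) (b s)]. *)
Definition weingarten_kernel f (i i' a b : I) : C :=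
  \sum_sigma \sum_tau delta_perm C sigma a b * delta_perm C tau i i' *
    f (tau * sigma^-1)%g.

(** Summing [delta_perm C sigma b b] over [b] gives [G sigma], which leaves the sum of
    [convol G f t * delta_perm C t i i']. For [N < k] the function [convol G f] may differ from the
    unit [delta1], but the difference is killed by convolution with [G] and hence contributes
    zero. *)
Lemma sum_weingarten_kernel_diag f : convol (convol G f) G = G ->
  forall i i', \sum_(b : I) weingarten_kernel f i i' b b = (i == i')%:R.
Proof.
move=> GfG i i'.
pose delta1 : {ffun 'S_k -> C} := [ffun s => (s == 1%g)%:R].
have d1G : convol delta1 G = G.
  apply/ffunP => pi; rewrite convolE (bigD1 1%g) //= big1 => [|t /negPf t1].
    by rewrite ffunE eqxx mul1r invg1 mulg1 addr0.
  by rewrite ffunE t1 mul0r.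
have subE t : (convol G f - delta1) t = convol G f t - delta1 t.
  by rewrite !ffunE.
have h0 : convol (convol G f - delta1) G = 0.
  apply/ffunP => pi; rewrite convolE.
  under eq_bigr => t _ do rewrite subE mulrBl.
  rewrite sumrB.
  have -> : \sum_(t : 'S_k) delta1 t * G (pi * t^-1)%g = G pi.
    by rewrite -[in RHS]d1G convolE.
  by rewrite -convolE GfG subrr ffunE.
have := sum_delta_perm_eq0 h0 i i'.
under eq_bigr => t _ do rewrite subE mulrBl.
rewrite sumrB => /eqP; rewrite subr_eq0 => /eqP E.
transitivity (\sum_(t : 'S_k) convol G f t * delta_perm C t i i').
  rewrite /weingarten_kernel exchange_big /=.
  under eq_bigr => sigma _ do rewrite exchange_big /=.
  rewrite exchange_big /=; apply: eq_bigr => tau _.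
  rewrite convolE mulr_suml; apply: eq_bigr => sigma _.
  rewrite -!mulr_suml mulrAC; congr (_ * _ * _).
  rewrite pow_kappaE; apply: eq_bigr => b _; apply: eq_bigr => s _.
  by rewrite eq_sym.
rewrite E (bigD1 1%g) //= big1 => [|t /negPf t1].
  rewrite ffunE eqxx mul1r addr0 delta_permE; congr (_ == _)%:R.
  by apply/ffunP => s; rewrite ffunE perm1.
by rewrite ffunE t1 mul0r.
Qed.

(** Permuting the positions multiplies [sigma] and [tau] by the same [rho], which cancels in
    [tau * sigma^-1]. *)
Lemma weingarten_kernel_perm f (rho : 'S_k) (i i' a b : I) :
  weingarten_kernel f [ffun s => i (rho s)] i' [ffun s => a (rho s)] b =
  weingarten_kernel f i i' a b.
Proof.
rewrite /weingarten_kernel [RHS](reindex_inj (mulIg rho)) /=.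
apply: eq_bigr => sigma _; rewrite [RHS](reindex_inj (mulIg rho)) /=.
apply: eq_bigr => tau _; rewrite invMg mulgA mulgK; congr (_ * _ * _).
  by rewrite /delta_perm; apply: eq_bigr => s _; rewrite ffunE permM.
by rewrite /delta_perm; apply: eq_bigr => s _; rewrite ffunE permM.
Qed.

End Weingarten.

(** * The commutant of the unitary tensor powers *)

Lemma exists_phase_infinite_order (C : numClosedFieldType) :
  exists2 w : C, `|w| = 1 & forall m, (0 < m)%N -> w ^+ m != 1.
Proof.
(* Modulo 5 every positive power of 3 + 4i is 3 + 4i, hence none is a real number;
   (3 + 4i) / 5 has modulus 1. *)
pose u : C := 3%:R + 'i * 4%:R.
have uX m : exists q r : int,
    u ^+ m.+1 = (3 + 5 * q)%:~R + 'i * (4 + 5 * r)%:~R.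
  elim: m => [|m [q [r IH]]]; first by exists 0, 0; rewrite !mulr0 !addr0.
  (* Multiplication by 3 + 4i gives real part -7 + 15q - 20r and imaginary part 24 + 20q + 15r,
     congruent to 3 and 4 modulo 5. *)
  exists (-2 + 3 * q - 4 * r), (4 + 3 * r + 4 * q).
  rewrite exprS IH /u !(intrD, intrM, rmorphN) /=.
  have i2 : 'i * 'i = -1 :> C by rewrite -expr2 sqrCi.
  transitivity (9%:R + 15%:R * q%:~R + 'i * 'i * (16%:R + 20%:R * r%:~R)
     + 'i * (24%:R + 15%:R * r%:~R + 20%:R * q%:~R) : C); first by ring.
  by rewrite i2; ring.
have five0 : 5%:R != 0 :> C by rewrite pnatr_eq0.
exists (u / 5%:R).
  have nu : `|u| = 5%:R.
    apply/eqP; rewrite -(eqrXn2 (n := 2)) ?normr_ge0 ?ler0n //.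
    by rewrite /u normC2_rect ?rpred_nat // -!natrX -natrD.
  by rewrite normf_div nu normr_nat divff.
case=> // m _; rewrite expr_div_n.
apply/eqP => /(canRL (mulfVK (expf_neq0 m.+1 five0))).
have [q [r ->]] := uX m; rewrite mul1r => /(congr1 (fun z : C => 'Im z)).
rewrite Im_rect ?rpred_int // (Creal_ImP _ _) ?rpredX ?rpred_nat //.
move=> /eqP; rewrite intr_eq0 => /eqP E.
have : (5 %| 4)%Z.
  have -> : 4 = 5 * (- r) :> int by rewrite mulrN; apply/eqP; rewrite -addr_eq0 E.
  by rewrite dvdz_mulr.
by [].
Qed.

Lemma prod_by_value (I J : finType) (F : comNzRingType) (a : I -> J) (d : J -> F) :
  \prod_s d (a s) = \prod_v d v ^+ #|[pred s | a s == v]|.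
Proof.
rewrite (partition_big a xpredT) //=; apply: eq_bigr => v _.
rewrite -prodr_const; apply: eq_big => [s|s /eqP -> //].
by rewrite inE.
Qed.

Lemma ffun_neq_ex (I : finType) (J : eqType) (a b : {ffun I -> J}) :
  a != b -> exists s, a s != b s.
Proof.
move=> ab; apply/existsP; apply: contraT; rewrite negb_exists => /forallP e.
by case/eqP: ab; apply/ffunP => s; apply/eqP; rewrite -[_ == _]negbK.
Qed.

Section Commutant.
Variables (C : numClosedFieldType) (N k : nat).
Local Notation I := {ffun 'I_k -> 'I_N}.
Implicit Types (g h : 'M[C]_N) (A B : I -> I -> C).

Definition tensor_power g (a b : I) : C := \prod_(s < k) g (a s) (b s).

Definition kernel_commute A B : Prop := forall i j : I,
  \sum_(a : I) A i a * B a j = \sum_(a : I) B i a * A a j.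

Lemma tensor_powerM g h i j :
  tensor_power (g *m h) i j = \sum_(a : I) tensor_power g i a * tensor_power h a j.
Proof.
rewrite /tensor_power; under eq_bigr => s _ do rewrite mxE.
by rewrite bigA_distr_bigA /=; apply: eq_bigr => a _; rewrite big_split.
Qed.

Lemma kernel_commuteM A g h : kernel_commute A (tensor_power g) ->
  kernel_commute A (tensor_power h) -> kernel_commute A (tensor_power (g *m h)).
Proof.
move=> Ag Ah i j.
transitivity (\sum_(b : I) (\sum_(a : I) A i a * tensor_power g a b) * tensor_power h b j).
  under eq_bigr => a _ do rewrite tensor_powerM mulr_sumr.
  rewrite exchange_big /=; apply: eq_bigr => b _; rewrite mulr_suml.
  by apply: eq_bigr => a _; rewrite mulrA.
transitivity (\sum_(b : I) tensor_power g i b * (\sum_(a : I) A b a * tensor_power h a j)).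
  under eq_bigr => b _ do rewrite Ag mulr_suml.
  rewrite exchange_big /=; apply: eq_bigr => b _; rewrite mulr_sumr.
  by apply: eq_bigr => a _; rewrite mulrA.
under eq_bigr => b _ do rewrite Ah mulr_sumr.
rewrite exchange_big /=; apply: eq_bigr => b _; rewrite tensor_powerM mulr_suml.
by apply: eq_bigr => a _; rewrite mulrA.
Qed.

Lemma kernel_commute_sum A (J : finType) (c : J -> C) (B : J -> I -> I -> C) :
  (forall t, kernel_commute A (B t)) ->
  kernel_commute A (fun i j => \sum_t c t * B t i j).
Proof.
move=> AB i j.
under eq_bigr => a _ do rewrite mulr_sumr.
under [RHS]eq_bigr => a _ do rewrite mulr_suml.
rewrite exchange_big [RHS]exchange_big /=; apply: eq_bigr => t _.
transitivity (c t * \sum_(a : I) A i a * B t a j).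
  by rewrite mulr_sumr; apply: eq_bigr => a _; rewrite mulrCA.
by rewrite AB mulr_sumr; apply: eq_bigr => a _; rewrite mulrA.
Qed.

Lemma kernel_commute_ext A B B' : (forall i j, B i j = B' i j) ->
  kernel_commute A B -> kernel_commute A B'.
Proof.
move=> BB AB i j; under eq_bigr => a _ do rewrite -BB.
by rewrite AB; apply: eq_bigr => a _; rewrite BB.
Qed.

Lemma tensor_power_diag (d : 'rV[C]_N) (a b : I) :
  tensor_power (diag_mx d) a b = (a == b)%:R * \prod_(s < k) d 0 (a s).
Proof.
have [<-|/ffun_neq_ex[s abs]] := eqVneq a b.
  by rewrite mul1r; apply: eq_bigr => s _; rewrite mxE eqxx.
rewrite mul0r; apply/eqP/prodf_eq0.
by exists s => //; rewrite mxE (negPf abs).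
Qed.

Lemma sum_tensor_diag_r A (d : 'rV[C]_N) i j :
  \sum_(a : I) A i a * tensor_power (diag_mx d) a j =
  A i j * \prod_(s < k) d 0 (j s).
Proof.
rewrite (bigD1 j) //= big1 ?addr0 => [|a /negPf aj].
  by rewrite tensor_power_diag eqxx mul1r.
by rewrite tensor_power_diag aj mul0r mulr0.
Qed.

Lemma sum_tensor_diag_l A (d : 'rV[C]_N) i j :
  \sum_(a : I) tensor_power (diag_mx d) i a * A a j =
  A i j * \prod_(s < k) d 0 (i s).
Proof.
rewrite (bigD1 i) //= big1 ?addr0 => [|a /negPf aj].
  by rewrite tensor_power_diag eqxx mul1r mulrC.
by rewrite tensor_power_diag eq_sym aj !mul0r.
Qed.

Variable A : I -> I -> C.
Hypothesis A_unitary :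
  forall U : 'M[C]_N, U \is unitarymx -> kernel_commute A (tensor_power U).

(** Where [A i j] is nonzero, [i] and [j] take each value [v] equally often: the diagonal unitary
    with entry [w] at [v] and 1 elsewhere gives equal powers of [w], which has infinite order. Both
    sides then carry the same product of entries of [d]. *)
Lemma commute_diag (d : 'rV[C]_N) : kernel_commute A (tensor_power (diag_mx d)).
Proof.
move=> i j; rewrite sum_tensor_diag_r sum_tensor_diag_l.
have [->|Aij] := eqVneq (A i j) 0; first by rewrite !mul0r.
congr (_ * _).
rewrite (prod_by_value j (d 0)) (prod_by_value i (d 0)).
apply: eq_bigr => v _; congr (_ ^+ _).
have [w w1 wX] := exists_phase_infinite_order C.
pose e : 'rV[C]_N := \row_x (if x == v then w else 1).
have ue : diag_mx e \is unitarymx.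
  apply/unitarymxP; apply/matrixP => x y; rewrite !mxE.
  rewrite (bigD1 x) //= big1 ?addr0 => [|z /negPf zx]; last first.
    by rewrite [diag_mx e x z]mxE [x == z]eq_sym zx mul0r.
  rewrite !mxE eqxx mulr1n; case: (eqVneq x y) => [<-|xy].
    by rewrite ?eqxx mulr1n -normCK; case: ifP => _; rewrite ?w1 ?normr1 expr1n.
  by rewrite ?[y == x]eq_sym ?(negPf xy) mulr0n conjC0 mulr0.
have eP (a : I) : \prod_(s < k) e 0 (a s) = w ^+ #|[pred s | a s == v]|.
  rewrite (prod_by_value a (e 0)) (bigD1 v) //= mxE eqxx big1 ?mulr1 //.
  by move=> x /negPf xv; rewrite mxE xv expr1n.
have := A_unitary ue i j.
rewrite sum_tensor_diag_r sum_tensor_diag_l !eP => /(mulfI Aij).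
set m1 := #|_|; set m2 := #|_|.
have w0 : w != 0 by rewrite -normr_eq0 w1 oner_neq0.
wlog le12 : m1 m2 / (m1 <= m2)%N.
  move=> W; case: (leqP m1 m2) => [|/ltnW] le; first exact: W.
  by move=> E; apply/esym/W.
rewrite -(subnKC le12) exprD => /esym /(canRL (mulKf (expf_neq0 _ w0))).
rewrite mulVf ?expf_neq0 // => E.
case: (posnP (m2 - m1)) => [->|/wX]; first by rewrite addn0.
by rewrite E eqxx.
Qed.

(** By the spectral theorem [H] is a unitary conjugate of a diagonal matrix, and commutation passes
    to products. *)
Lemma commute_hermitian (H : 'M[C]_N) : H ^t* = H ->
  kernel_commute A (tensor_power H).
Proof.
move=> hH.
have /orthomx_spectralP -> : H \is normalmx by apply/normalmxP; rewrite hH.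
have su := spectral_unitarymx H.
rewrite invmx_unitary //; apply: kernel_commuteM.
  apply: kernel_commuteM; last exact: commute_diag.
  by apply: A_unitary; rewrite trmxC_unitary.
exact: A_unitary.
Qed.

End Commutant.

(** * Polarization and commutation with symmetric kernels *)

Lemma sum_ffun_injective (F : nmodType) (k : nat) (f : {ffun 'I_k -> 'I_k} -> F) :
  \sum_(a : {ffun 'I_k -> 'I_k} | injectiveb a) f a =
  \sum_(rho : 'S_k) f (finfun rho).
Proof.
pose h' (a : {ffun 'I_k -> 'I_k}) : 'S_k :=
  if @injectiveP _ _ a is ReflectT inj then perm inj else 1%g.
rewrite (reindex_onto (fun rho : 'S_k => finfun rho) h') /=; last first.
  move=> a; rewrite /h'; case: injectiveP => // inj _.
  by apply/ffunP => s; rewrite ffunE permE.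
apply: eq_bigl => rho; apply/andP; split.
  by apply/injectiveP => x y; rewrite !ffunE => /perm_inj.
apply/eqP/permP => s; rewrite /h'; case: injectiveP => [inj|[]].
  by rewrite permE ffunE.
by move=> x y; rewrite !ffunE => /perm_inj.
Qed.

Section Polarization.
Variables (F : comNzRingType) (k : nat).

Lemma sum_bool_sign (m : nat) :
  \sum_(b : bool) (-1) ^+ (~~ b) * (b%:R ^+ m) = (m != 0%N)%:R :> F.
Proof.
rewrite big_bool /= expr0 mul1r expr1n expr1 mulN1r expr0n.
by case: m => [|m] /=; rewrite ?subrr ?subr0.
Qed.

(** Ryser's inclusion-exclusion formula for the permanent. After expanding over choice functions
    [a], the sum over [e] factors over [t], with factor 1 if [t] is a value of [a] and 0 otherwise;
    only the surjective, hence bijective, [a] survive. *)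
Lemma ryser_permanent (x : 'I_k -> 'I_k -> F) :
  \sum_(e : {ffun 'I_k -> bool}) (\prod_t (-1) ^+ (~~ e t)) *
      \prod_s \sum_t (e t)%:R * x t s =
  \sum_(rho : 'S_k) \prod_s x (rho s) s.
Proof.
transitivity (\sum_(a : {ffun 'I_k -> 'I_k}) (\prod_s x (a s) s) *
    \sum_(e : {ffun 'I_k -> bool}) (\prod_t (-1) ^+ (~~ e t)) *
       \prod_s (e (a s))%:R).
  under eq_bigr => e _ do rewrite bigA_distr_bigA mulr_sumr /=.
  rewrite exchange_big /=; apply: eq_bigr => a _; rewrite mulr_sumr.
  by apply: eq_bigr => e _; rewrite big_split /= mulrA mulrC.
transitivity (\sum_(a : {ffun 'I_k -> 'I_k} | injectiveb a) \prod_s x (a s) s).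
  rewrite [RHS]big_mkcond /=; apply: eq_bigr => a _.
  have -> : \sum_(e : {ffun 'I_k -> bool}) (\prod_t (-1) ^+ (~~ e t)) *
       \prod_s (e (a s))%:R =
     \sum_(e : {ffun 'I_k -> bool}) \prod_t ((-1) ^+ (~~ e t) *
       (e t)%:R ^+ #|[pred s | a s == t]|) :> F.
    apply: eq_bigr => e _.
    by rewrite (prod_by_value a (fun t => (e t)%:R)) -big_split.
  rewrite -(bigA_distr_bigA (fun t (b : bool) =>
     (-1) ^+ (~~ b) * b%:R ^+ #|[pred s | a s == t]|)) /=.
  under [X in _ * X]eq_bigr => t _ do rewrite sum_bool_sign.
  rewrite prod_natr_bool.
  suff -> : [forall t, #|[pred s | a s == t]| != 0%N] = injectiveb a.
    by case: ifP; rewrite ?mulr1 ?mulr0.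
  apply/forallP/injectiveP => [sur|inj t].
    have imT : codom a =i predT.
      move=> t; rewrite inE; apply/codomP.
      have /card_gt0P[s] : (0 < #|[pred s | a s == t]|)%N by rewrite lt0n sur.
      by rewrite inE => /eqP <-; exists s.
    by apply/injectiveP/card_uniqP; rewrite (eq_card imT) size_codom.
  have [b ab ba] : bijective a by apply: injF_bij.
  by rewrite -lt0n; apply/card_gt0P; exists (b t); rewrite inE ba.
rewrite sum_ffun_injective; apply: eq_bigr => rho _.
by apply: eq_bigr => s _; rewrite ffunE.
Qed.

End Polarization.

Section SymmetricKernels.
Variables (C : numClosedFieldType) (N k : nat).
Local Notation I := {ffun 'I_k -> 'I_N}.

(** This is [k!] times the symmetrization of the tensor product of the matrices [g t]. *)
Definition sym_kernel (g : 'I_k -> 'M[C]_N) (a b : I) : C :=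
  \sum_(rho : 'S_k) \prod_s g (rho s) (a s) (b s).

Variable A : I -> I -> C.
Hypothesis A_unitary :
  forall U : 'M[C]_N, U \is unitarymx -> kernel_commute A (tensor_power U).

(** Ryser's formula, applied entrywise, writes the symmetrized product as a signed sum of tensor
    powers of the partial sums of the [H t], which are Hermitian. *)
Lemma commute_sym_hermitian (H : 'I_k -> 'M[C]_N) :
  (forall t, (H t) ^t* = H t) -> kernel_commute A (sym_kernel H).
Proof.
move=> hH.
apply: (kernel_commute_ext (B := fun a b =>
  \sum_(e : {ffun 'I_k -> bool}) (\prod_t (-1) ^+ (~~ e t)) *
     tensor_power (\sum_t (e t)%:R *: H t) a b)) => [a b|].
  rewrite /sym_kernel -(ryser_permanent (fun t s => H t (a s) (b s))).
  apply: eq_bigr => e _; congr (_ * _); apply: eq_bigr => s _.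
  by rewrite summxE; apply: eq_bigr => t _; rewrite mxE.
apply: kernel_commute_sum => e; apply: commute_hermitian A_unitary _ _.
apply/matrixP => x y; rewrite !mxE !summxE rmorph_sum.
apply: eq_bigr => t _; rewrite !mxE rmorphM /= conjC_nat; congr (_ * _).
by move/matrixP: (hH t) => /(_ x y); rewrite !mxE.
Qed.

Lemma commute_sym (g : 'I_k -> 'M[C]_N) : kernel_commute A (sym_kernel g).
Proof.
(* Cartesian decomposition of [g t] into Hermitian matrices, [H t true + 'i * H t false]; the
   symmetrized product is then expanded multilinearly. *)
pose H (t : 'I_k) (b : bool) : 'M[C]_N :=
  if b then 2%:R^-1 *: (g t + (g t)^t*) else (2%:R * 'i)^-1 *: (g t - (g t)^t*).
pose c (b : bool) : C := if b then 1 else 'i.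
have two0 : 2%:R != 0 :> C by rewrite pnatr_eq0.
have hH t b : (H t b) ^t* = H t b.
  case: b; apply/matrixP => x y; rewrite !mxE rmorphM /= fmorphV /=.
    by rewrite conjC_nat rmorphD /= conjCK addrC.
  rewrite rmorphM /= conjC_nat conjCi rmorphB /= conjCK.
  by rewrite mulrN invrN mulNr -mulrN opprB.
have gE t x y : g t x y = \sum_(b : bool) c b * H t b x y.
  rewrite big_bool /= mul1r !mxE invfM mulrA [_^-1 * 'i^-1]mulrC mulrA.
  rewrite divff ?neq0Ci // mul1r -mulrDr addrACA subrr addr0 -mulr2n.
  by rewrite -[g t x y *+ 2]mulr_natl mulKf.
apply: (kernel_commute_ext (B := fun a b =>
  \sum_(e : {ffun 'I_k -> bool}) (\prod_t c (e t)) *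
     sym_kernel (fun t => H t (e t)) a b)) => [a b|]; last first.
  by apply: kernel_commute_sum => e; apply: commute_sym_hermitian.
rewrite /sym_kernel.
under eq_bigr => e _ do rewrite mulr_sumr.
rewrite exchange_big /=; apply: eq_bigr => rho _.
have re (f : 'I_k -> 'I_k -> C) : \prod_s f (rho s) s = \prod_t f t (rho^-1 t)%g.
  rewrite [RHS](reindex_inj (perm_inj (s := rho))) /=.
  by apply: eq_bigr => s _; rewrite permK.
rewrite [RHS](re (fun t s => g t (a s) (b s))).
under [RHS]eq_bigr => t _ do rewrite gE.
rewrite bigA_distr_bigA /=; apply: eq_bigr => e _.
by rewrite big_split /= (re (fun t s => H t (e t) (a s) (b s))).
Qed.

(** Being invariant, [B] equals its average over [rho]. Expanding it in tensor products of matrix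
    units therefore expresses it as a combination of symmetrized products. *)
Lemma commute_symmetric (B : I -> I -> C) :
  (forall (rho : 'S_k) (a b : I),
     B [ffun s => a (rho s)] [ffun s => b (rho s)] = B a b) ->
  kernel_commute A B.
Proof.
move=> symB.
have k0 : (k`!)%:R != 0 :> C by rewrite pnatr_eq0 -lt0n fact_gt0.
apply: (kernel_commute_ext (B := fun a b => \sum_(q : I * I)
   ((k`!)%:R^-1 * B q.1 q.2) *
   sym_kernel (fun t => delta_mx (q.1 t) (q.2 t)) a b)) => [x y|]; last first.
  by apply: kernel_commute_sum => q; apply: commute_sym.
under eq_bigr => q _ do rewrite -mulrA.
rewrite -mulr_sumr; apply: (canLR (mulKf k0)).
under eq_bigr => q _ do rewrite mulr_sumr.
rewrite exchange_big /= -card_Sn mulr_natl -sumr_const.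
apply: eq_bigr => rho _; rewrite -(pair_bigA _ (fun a b => B a b *
  \prod_s delta_mx (a (rho s)) (b (rho s)) (x s) (y s))) /=.
have inj : injective (fun a : I => [ffun s => a ((rho^-1)%g s)] : I).
  move=> a b /ffunP ab; apply/ffunP => s.
  by have := ab (rho s); rewrite !ffunE permK.
rewrite (reindex_inj inj) (bigD1 x) //= [X in _ + X]big1 ?addr0 => [|a ax]; last first.
  apply: big1 => b _; apply/eqP; rewrite mulf_eq0; apply/orP; right.
  have [s xs] : exists s, x s != a s by apply: ffun_neq_ex; rewrite eq_sym.
  by apply/prodf_eq0; exists s => //; rewrite mxE ffunE permK (negPf xs).
rewrite (reindex_inj inj) (bigD1 y) //= [X in _ + X]big1 ?addr0 => [|b bx]; last first.
  apply/eqP; rewrite mulf_eq0; apply/orP; right.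
  have [s xs] : exists s, y s != b s by apply: ffun_neq_ex; rewrite eq_sym.
  by apply/prodf_eq0; exists s => //; rewrite mxE !ffunE !permK (negPf xs) andbF.
rewrite symB big1 ?mulr1 // => s _; by rewrite mxE !ffunE !permK !eqxx.
Qed.

End SymmetricKernels.

(** * Complex-valued random variables *)

Section ComplexMeasurability.
Local Open Scope classical_set_scope.
Context {d : measure_display} {T : measurableType d} {R : realType}.
Implicit Type Z : T -> R[i].

Definition complex_measurable Z : Prop :=
  measurable_fun setT (fun t => complex.Re (Z t)) /\
  measurable_fun setT (fun t => complex.Im (Z t)).

Lemma complex_measurableM Z1 Z2 : complex_measurable Z1 ->
  complex_measurable Z2 -> complex_measurable (fun t => Z1 t * Z2 t).
Proof.
move=> [r1 i1] [r2 i2]; split.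
  rewrite (_ : (fun t => _) = (fun t => complex.Re (Z1 t) * complex.Re (Z2 t)
     - complex.Im (Z1 t) * complex.Im (Z2 t))).
    by apply: measurable_funB; apply: measurable_funM.
  by apply/funext => t; case: (Z1 t) (Z2 t) => [? ?] [? ?].
rewrite (_ : (fun t => _) = (fun t => complex.Re (Z1 t) * complex.Im (Z2 t)
     + complex.Im (Z1 t) * complex.Re (Z2 t))).
  by apply: measurable_funD; apply: measurable_funM.
by apply/funext => t; case: (Z1 t) (Z2 t) => [? ?] [? ?].
Qed.

Lemma complex_measurable_prod (I : finType) (Z : I -> T -> R[i]) :
  (forall s, complex_measurable (Z s)) ->
  complex_measurable (fun t => \prod_s Z s t).
Proof.
move=> mZ; elim: (index_enum I) => [|s r IH].
  by split; under eq_fun do rewrite big_nil; apply: measurable_cst.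
rewrite (_ : (fun t => _) = (fun t => Z s t * \prod_(s <- r) Z s t)).
  exact: complex_measurableM.
by apply/funext => t; rewrite big_cons.
Qed.

Lemma complex_measurable_conj Z :
  complex_measurable Z -> complex_measurable (fun t => Num.conj (Z t)).
Proof.
move=> [rZ iZ]; split.
  rewrite (_ : (fun t => _) = (fun t => complex.Re (Z t))) //.
  by apply/funext => t; case: (Z t).
rewrite (_ : (fun t => _) = (fun t => - complex.Im (Z t))).
  exact: measurableT_comp.
by apply/funext => t; case: (Z t).
Qed.

End ComplexMeasurability.

Section ComplexExpectation.
Local Open Scope classical_set_scope.
Context {d : measure_display} {T : measurableType d} {R : realType}.
Variable P : probability T R.
Implicit Type Z : T -> R[i].
Local Notation E := (complex_expectation P).
Local Notation integrable Z := (complex_integrable P Z).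

Lemma complex_expectationE Z :
  E Z = Complex (Rintegral P setT (fun t => complex.Re (Z t)))
                (Rintegral P setT (fun t => complex.Im (Z t))).
Proof. by rewrite /complex_expectation !unlock. Qed.

Lemma complex_integrableD Z1 Z2 :
  integrable Z1 -> integrable Z2 -> integrable (fun t => Z1 t + Z2 t).
Proof.
move=> [r1 i1] [r2 i2]; split.
  rewrite (_ : (fun t => _) =
    (fun t => ((complex.Re (Z1 t))%:E + (complex.Re (Z2 t))%:E)%E)).
    exact: integrableD.
  by apply/funext => t; case: (Z1 t) (Z2 t) => [? ?] [? ?].
rewrite (_ : (fun t => _) =
    (fun t => ((complex.Im (Z1 t))%:E + (complex.Im (Z2 t))%:E)%E)).
  exact: integrableD.
by apply/funext => t; case: (Z1 t) (Z2 t) => [? ?] [? ?].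
Qed.

Lemma complex_expectationD Z1 Z2 : integrable Z1 -> integrable Z2 ->
  E (fun t => Z1 t + Z2 t) = E Z1 + E Z2.
Proof.
move=> [r1 i1] [r2 i2]; rewrite !complex_expectationE; congr Complex.
  rewrite -RintegralD //; congr Rintegral.
  by apply/funext => t; case: (Z1 t) (Z2 t) => [? ?] [? ?].
rewrite -RintegralD //; congr Rintegral.
by apply/funext => t; case: (Z1 t) (Z2 t) => [? ?] [? ?].
Qed.

Lemma real_integrableZ (r : R) (f : T -> R) :
  P.-integrable setT (EFin \o f) -> P.-integrable setT (EFin \o (fun t => r * f t)).
Proof. by move=> fi; have := integrableZl measurableT r fi. Qed.

Lemma complex_integrableZ (c : R[i]) Z :
  integrable Z -> integrable (fun t => c * Z t).
Proof.
case: c => a b [rZ iZ]; split.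
  rewrite (_ : (fun t => _) = ((EFin \o (fun t => a * complex.Re (Z t))%R) \+
     (EFin \o (fun t => (- b) * complex.Im (Z t))%R))%E).
    by apply: integrableD => //; apply: real_integrableZ.
  by apply/funext => t /=; case: (Z t) => [? ?] /=; rewrite mulNr.
rewrite (_ : (fun t => _) = ((EFin \o (fun t => a * complex.Im (Z t))%R) \+
     (EFin \o (fun t => b * complex.Re (Z t))%R))%E).
  by apply: integrableD => //; apply: real_integrableZ.
by apply/funext => t /=; case: (Z t) => [? ?].
Qed.

Lemma complex_expectationZ (c : R[i]) Z :
  integrable Z -> E (fun t => c * Z t) = c * E Z.
Proof.
case: c => a b [rZ iZ]; rewrite !complex_expectationE.
rewrite [RHS]/GRing.mul /=; congr Complex.
  rewrite -!RintegralZl // -RintegralB //; try exact: real_integrableZ.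
  by congr Rintegral; apply/funext => t; case: (Z t).
rewrite -!RintegralZl // -RintegralD //; try exact: real_integrableZ.
by congr Rintegral; apply/funext => t; case: (Z t).
Qed.

Lemma complex_integrable0 : integrable (fun=> 0).
Proof. by split; apply: integrable0. Qed.

Lemma complex_expectation0 : E (fun=> 0) = 0.
Proof. by rewrite complex_expectationE; congr Complex; rewrite Rintegral_cst // mul0r. Qed.

Lemma complex_integrable_sum (J : finType) (c : J -> R[i]) (Z : J -> T -> R[i]) :
  (forall s, integrable (Z s)) -> integrable (fun t => \sum_s c s * Z s t).
Proof.
move=> iZ; elim: (index_enum J) => [|s r IH].
  rewrite (_ : (fun t => _) = fun=> 0); first exact: complex_integrable0.
  by apply/funext => t; rewrite big_nil.
rewrite (_ : (fun t => _) = (fun t => c s * Z s t + \sum_(s <- r) c s * Z s t)).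
  by apply: complex_integrableD => //; apply: complex_integrableZ.
by apply/funext => t; rewrite big_cons.
Qed.

Lemma complex_expectation_sum (J : finType) (c : J -> R[i]) (Z : J -> T -> R[i]) :
  (forall s, integrable (Z s)) ->
  E (fun t => \sum_s c s * Z s t) = \sum_s c s * E (Z s).
Proof.
move=> iZ.
suff [] : integrable (fun t => \sum_s c s * Z s t) /\
    E (fun t => \sum_s c s * Z s t) = \sum_s c s * E (Z s) by [].
elim: (index_enum J) => [|s r [IHi IHe]].
  rewrite (_ : (fun t => _) = fun=> 0); last by apply/funext => t; rewrite big_nil.
  by split; [exact: complex_integrable0 | rewrite big_nil complex_expectation0].
rewrite (_ : (fun t => _) = (fun t => c s * Z s t + \sum_(s <- r) c s * Z s t)); last first.
  by apply/funext => t; rewrite big_cons.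
have iZs : integrable (fun t => c s * Z s t) by apply: complex_integrableZ.
split; first exact: complex_integrableD.
by rewrite complex_expectationD // complex_expectationZ // IHe big_cons.
Qed.

Lemma complex_integrable_le Z (f : T -> R) : complex_measurable Z ->
  P.-integrable setT (EFin \o f) -> (forall t, `|Z t| <= (f t)%:C%C) ->
  integrable Z.
Proof.
move=> [mr mi] fi Zf.
have Re_le t : `|complex.Re (Z t)| <= f t.
  by rewrite -lecR; apply: le_trans (normc_ge_Re _) (Zf t).
have Im_le t : `|complex.Im (Z t)| <= f t.
  (* Up to sign, the imaginary part of a number is the real part of its product with i, which has
     the same modulus. *)
  rewrite -normrN -ReiNIm -lecR; apply: le_trans (normc_ge_Re _) _.
  by rewrite complexiE normrM normCi mulr1.
have f0 t : 0 <= f t by apply: le_trans (Re_le t).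
split; apply: le_integrable fi => //.
- exact/measurable_EFinP.
- by move=> t _ /=; rewrite lee_fin [leRHS]ger0_norm.
- exact/measurable_EFinP.
- by move=> t _ /=; rewrite lee_fin [leRHS]ger0_norm.
Qed.

End ComplexExpectation.

(** * Moments of the random matrix *)

Section RintegralDistribution.
Local Open Scope classical_set_scope.

(** Both sides are integrals of the identity of [R] against image measures that agree on all Borel
    sets. *)
Lemma Rintegral_eq_distribution {d : measure_display} {T : measurableType d}
    {R : realType} (P : probability T R) (f g : T -> R) :
  P.-integrable setT (EFin \o f) -> P.-integrable setT (EFin \o g) ->
  (forall B, measurable B -> P (f @^-1` B) = P (g @^-1` B)) ->
  Rintegral P setT f = Rintegral P setT g.
Proof.
move=> fi gi fg.
have mf : measurable_fun setT f by apply/measurable_EFinP; apply: measurable_int fi.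
have mg : measurable_fun setT g by apply/measurable_EFinP; apply: measurable_int gi.
rewrite /Rintegral; congr fine.
have := integral_pushforward mf (mu := P) (@EFin_measurable R setT) fi measurableT.
rewrite preimage_setT => <-.
have := integral_pushforward mg (mu := P) (@EFin_measurable R setT) gi measurableT.
rewrite preimage_setT => <-.
by apply: eq_measure_integral => B mB _; apply: fg.
Qed.

End RintegralDistribution.

(* [g_sigma_algebraType] requires a pointed carrier. *)
HB.instance Definition _ (R : realType) := isPointed.Build R[i] 0.

Section Moments.
Local Open Scope classical_set_scope.
Context {R : realType} {n p k : nat}.

Definition monomial (M : 'M[R[i]]_(n, p)) (i i' : {ffun 'I_k -> 'I_n})
    (j j' : {ffun 'I_k -> 'I_p}) : R[i] :=
  (\prod_(s < k) M (i s) (j s)) * Num.conj (\prod_(s < k) M (i' s) (j' s)).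

Lemma complex_measurable_monomial {d : measure_display} {T : measurableType d}
    (X : T -> 'M[R[i]]_(n, p)) i i' j j' :
  (forall a b, complex_measurable (fun t => X t a b)) ->
  complex_measurable (fun t => monomial (X t) i i' j j').
Proof.
move=> mX; apply: complex_measurableM.
  by apply: complex_measurable_prod.
by apply: complex_measurable_conj; apply: complex_measurable_prod.
Qed.

(** On the space of matrices with the sigma-algebra generated by [G], the entries are measurable by
    construction, hence so are the monomials. *)
Lemma mx_borel_monomial i i' j j' (B : set R) : measurable B ->
  mx_borel [set M : 'M[R[i]]_(n, p) | B (complex.Re (monomial M i i' j j'))] /\
  mx_borel [set M : 'M[R[i]]_(n, p) | B (complex.Im (monomial M i i' j j'))].
Proof.
move=> mB.
pose G := [set A : set 'M[R[i]]_(n, p) |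
   exists (i : 'I_n) (j : 'I_p) (B : set R), measurable B /\
        (A = [set M : 'M[R[i]]_(n, p) | B (complex.Re (M i j))] \/
         A = [set M : 'M[R[i]]_(n, p) | B (complex.Im (M i j))])].
have [mRe mIm] : complex_measurable
    (fun M : g_sigma_algebraType G => monomial M i i' j j').
  apply: complex_measurable_monomial => a b.
  split=> _ C mC; rewrite setTI; apply: sub_sigma_algebra.
    by exists a, b, C; split; [|left].
  by exists a, b, C; split; [|right].
by split; [have := mRe measurableT B mB | have := mIm measurableT B mB]; rewrite setTI.
Qed.

Lemma random_matrix_entry {d : measure_display} {T : measurableType d}
    (X : T -> 'M[R[i]]_(n, p)) a b :
  random_matrix X -> complex_measurable (fun t => X t a b).
Proof.
move=> rX; split=> _ B mB; rewrite setTI.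
  apply: (rX [set M | B (complex.Re (M a b))]).
  by apply: sub_sigma_algebra; exists a, b, B; split; [|left].
apply: (rX [set M | B (complex.Im (M a b))]).
by apply: sub_sigma_algebra; exists a, b, B; split; [|right].
Qed.

Lemma Tr_perm_monomial (M : 'M[R[i]]_(n, p)) (x0 : 'I_n) (pi : 'S_k) :
  Tr_perm pi (M *m M ^t*) =
  \sum_(a : {ffun 'I_k -> 'I_n}) \sum_(c : {ffun 'I_k -> 'I_p})
    monomial M a [ffun s => a (pi s)] c c.
Proof.
rewrite -(sum_prod_perm _ x0); apply: eq_bigr => a _.
under eq_bigr => s _ do rewrite mxE.
rewrite bigA_distr_bigA; apply: eq_bigr => c _.
rewrite /monomial rmorph_prod -big_split; apply: eq_bigr => s _.
by rewrite !mxE ffunE.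
Qed.

(** Each of the 2k entries has squared modulus at most the trace of [M *m M ^t*], and [Tr_perm] at
    the identity is the k-th power of this trace. This bound makes all the moments integrable. *)
Lemma norm_monomial_le (M : 'M[R[i]]_(n, p)) (x0 : 'I_n) i i' j j' :
  `|monomial M i i' j j'| <= Tr_perm (1%g : 'S_k) (M *m M ^t*).
Proof.
have tr_sum : \tr (M *m M ^t*) = \sum_a \sum_b `|M a b| ^+ 2.
  apply: eq_bigr => a _; rewrite mxE; apply: eq_bigr => b _.
  by rewrite !mxE normCK.
have -> : Tr_perm (1%g : 'S_k) (M *m M ^t*) = \prod_(s < k) \tr (M *m M ^t*).
  rewrite -(sum_prod_perm _ x0) bigA_distr_bigA; apply: eq_bigr => a _.
  by apply: eq_bigr => s _; rewrite perm1.
rewrite /monomial normrM norm_conjC !normr_prod -big_split /=.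
have entry_le a b : `|M a b| ^+ 2 <= \tr (M *m M ^t*).
  rewrite tr_sum (bigD1 a) //= (bigD1 b) //= -addrA lerDl addr_ge0 //.
    by apply: sumr_ge0 => c _; rewrite exprn_ge0.
  by apply: sumr_ge0 => c _; apply: sumr_ge0 => e _; rewrite exprn_ge0.
have tr0 : 0 <= \tr (M *m M ^t*).
  by rewrite tr_sum; apply: sumr_ge0 => c _; apply: sumr_ge0 => e _; rewrite exprn_ge0.
apply: ler_prod => s _; rewrite mulr_ge0 //=.
rewrite -(ler_pXn2r (n := 2)) ?nnegrE ?mulr_ge0 // exprMn [leRHS]expr2.
by apply: ler_pM; rewrite ?exprn_ge0.
Qed.

End Moments.

(** * Invariance of the moment tensor and its contractions *)

Section InvariantMoments.
Local Open Scope classical_set_scope.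
Context {R : realType} {d : measure_display} {T : measurableType d}.
Variables (P : probability T R) (n p k : nat) (x0 : 'I_n).
Variable X : T -> 'M[R[i]]_(n, p).
Hypothesis X_random : random_matrix X.
Hypothesis X_invariant : forall (U : 'M[R[i]]_n) (V : 'M[R[i]]_p),
  U \is unitarymx -> V \is unitarymx ->
  same_distribution P X (fun t => U *m X t *m V).
Hypothesis X_moments : forall pi : 'S_k,
  complex_integrable P (fun t => Tr_perm pi (X t *m (X t)^t*)).
Local Notation In := {ffun 'I_k -> 'I_n}.
Local Notation Ip := {ffun 'I_k -> 'I_p}.

Lemma monomial_integrable (i i' : In) (j j' : Ip) :
  complex_integrable P (fun t => monomial (X t) i i' j j').
Proof.
apply: (complex_integrable_le (f := fun t =>
    complex.Re (Tr_perm (1%g : 'S_k) (X t *m (X t)^t*)))).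
- by apply: complex_measurable_monomial => a b; apply: random_matrix_entry.
- by have [] := X_moments 1%g.
- move=> t; have le := norm_monomial_le (X t) x0 i i' j j'.
  by rewrite RRe_real // ger0_real // (le_trans _ le).
Qed.

Definition moment (i i' : In) (j j' : Ip) : R[i] :=
  complex_expectation P (fun t => monomial (X t) i i' j j').

(** The moment depends only on the law, so it may be computed with [Y]; the expansion into monomials
    of [X] gives both integrability and, by linearity, the value. *)
Lemma moment_sum (J : finType) (c : J -> R[i]) (a a' : J -> In) (b b' : J -> Ip)
    (Y : T -> 'M[R[i]]_(n, p)) i i' j j' :
  same_distribution P X Y ->
  (forall t, monomial (Y t) i i' j j' =
     \sum_q c q * monomial (X t) (a q) (a' q) (b q) (b' q)) ->
  moment i i' j j' = \sum_q c q * moment (a q) (a' q) (b q) (b' q).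
Proof.
move=> XY YE.
have iX q := monomial_integrable (a q) (a' q) (b q) (b' q).
have YF : (fun t => monomial (Y t) i i' j j') =
    (fun t => \sum_q c q * monomial (X t) (a q) (a' q) (b q) (b' q)).
  exact/funext.
have [rY iY] : complex_integrable P (fun t => monomial (Y t) i i' j j').
  by rewrite YF; apply: complex_integrable_sum.
have -> : \sum_q c q * moment (a q) (a' q) (b q) (b' q) =
    complex_expectation P (fun t => monomial (Y t) i i' j j').
  by rewrite YF complex_expectation_sum.
have [rX iX'] := monomial_integrable i i' j j'.
rewrite /moment !complex_expectationE; congr Complex;
  apply: Rintegral_eq_distribution => // B mB;
  have [mRe mIm] := mx_borel_monomial i i' j j' mB.
  exact: XY _ mRe.
exact: XY _ mIm.
Qed.

Lemma unitarymx1 (m : nat) : (1%:M : 'M[R[i]]_m) \is unitarymx.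
Proof. by apply/unitarymxP; rewrite trmx1 map_mx1 mul1mx. Qed.

Lemma moment_row_invariant (U : 'M[R[i]]_n) i i' j j' : U \is unitarymx ->
  \sum_(a : In) \sum_(b : In)
    tensor_power U i a * (tensor_power U i' b)^* * moment a b j j' =
  moment i i' j j'.
Proof.
move=> Uu; rewrite pair_bigA /=; apply/esym.
apply: (moment_sum (a := fst) (a' := snd) (b := fun=> j) (b' := fun=> j')
  (X_invariant Uu (unitarymx1 p))) => t.
rewrite mulmx1 -(pair_bigA _ (fun a b =>
    (tensor_power U i a * (tensor_power U i' b)^*) * monomial (X t) a b j j')) /=.
have prodE (x : In) (y : Ip) : \prod_(s < k) (U *m X t) (x s) (y s) =
    \sum_(a : In) tensor_power U x a * \prod_(s < k) X t (a s) (y s).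
  under eq_bigr => s _ do rewrite mxE.
  by rewrite bigA_distr_bigA /=; apply: eq_bigr => a _; rewrite big_split.
rewrite /monomial !prodE rmorph_sum mulr_suml; apply: eq_bigr => a _ /=.
by rewrite mulr_sumr; apply: eq_bigr => b _; rewrite rmorphM mulrACA.
Qed.

Lemma moment_col_invariant (V : 'M[R[i]]_p) i i' j j' : V \is unitarymx ->
  \sum_(a : Ip) \sum_(b : Ip)
    tensor_power V j a * (tensor_power V j' b)^* * moment i i' a b =
  moment i i' j j'.
Proof.
move=> Vu; rewrite pair_bigA /=; apply/esym.
(* Taking [V^T] as right factor puts the column index first in [V], so that columns transform
   exactly like rows. *)
have VTu : V^T \is unitarymx by rewrite trmx_unitary.
apply: (moment_sum (a := fun=> i) (a' := fun=> i') (b := fst) (b' := snd)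
  (X_invariant (unitarymx1 n) VTu)) => t.
rewrite mul1mx -(pair_bigA _ (fun a b =>
    (tensor_power V j a * (tensor_power V j' b)^*) * monomial (X t) i i' a b)) /=.
have prodE (x : In) (y : Ip) : \prod_(s < k) (X t *m V^T) (x s) (y s) =
    \sum_(a : Ip) tensor_power V y a * \prod_(s < k) X t (x s) (a s).
  under eq_bigr => s _ do rewrite mxE.
  rewrite bigA_distr_bigA /=; apply: eq_bigr => a _.
  by rewrite big_split mulrC; congr (_ * _); apply: eq_bigr => s _; rewrite mxE.
rewrite /monomial !prodE rmorph_sum mulr_suml; apply: eq_bigr => a _ /=.
by rewrite mulr_sumr; apply: eq_bigr => b _; rewrite rmorphM mulrACA.
Qed.

(** The deltas force [b] to be [a] after [sigma1] and [e] to be [c] after [sigma2]. Reindexing the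
    conjugated product by [sigma2^-1] restores [c] and leaves [sigma2^-1 * sigma1] on the row
    index. *)
Lemma moment_Tr_perm (sigma1 sigma2 : 'S_k) :
  \sum_(a : In) \sum_(b : In) \sum_(c : Ip) \sum_(e : Ip)
    delta_perm R[i] sigma1 a b * delta_perm R[i] sigma2 c e * moment a b c e =
  complex_expectation P
    (fun t => Tr_perm (sigma2^-1 * sigma1)%g (X t *m (X t)^t*)).
Proof.
transitivity (\sum_(a : In) \sum_(c : Ip)
    moment a [ffun s => a (sigma1 s)] c [ffun s => c (sigma2 s)]).
  apply: eq_bigr => a _; rewrite (bigD1 [ffun s => a (sigma1 s)]) //=.
  rewrite [X in _ + X]big1 ?addr0; last first.
    move=> b /negPf ab; apply: big1 => c _; apply: big1 => e _.
    by rewrite delta_permE eq_sym ab !mul0r.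
  apply: eq_bigr => c _; rewrite (bigD1 [ffun s => c (sigma2 s)]) //=.
  rewrite [X in _ + X]big1 ?addr0; last first.
    move=> e /negPf ce.
    by rewrite [delta_perm _ sigma2 _ _]delta_permE eq_sym ce mulr0 mul0r.
  by rewrite !delta_permE !eqxx !mul1r.
rewrite pair_bigA /=.
under eq_bigr => q _ do rewrite -[moment _ _ _ _]mul1r.
rewrite -complex_expectation_sum; last by move=> q; apply: monomial_integrable.
congr (complex_expectation P _); apply/funext => t.
rewrite (Tr_perm_monomial _ x0) pair_bigA /=; apply: eq_bigr => -[a c] _.
rewrite mul1r /monomial /=; congr (_ * (_)^*).
rewrite (reindex_inj (perm_inj (s := sigma2^-1%g))) /=; apply: eq_bigr => s _.
by rewrite !ffunE permKV permM.
Qed.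

End InvariantMoments.

(** * The reproducing property of the Weingarten kernel *)

Section Reproducing.
Variables (C : numClosedFieldType) (N k : nat) (x0 : 'I_N).
Local Notation I := {ffun 'I_k -> 'I_N}.

Lemma tensor_power_unitary (U : 'M[C]_N) (b j : I) : U \is unitarymx ->
  \sum_(i' : I) (tensor_power U i' b)^* * tensor_power U i' j = (b == j)%:R.
Proof.
move=> Uu.
have <- : tensor_power (U^t* *m U) b j = (b == j)%:R.
  have -> : U^t* *m U = 1%:M.
    have := mulVmx (unitarymx_unit Uu); by rewrite invmx_unitary.
  have -> : 1%:M = diag_mx (const_mx 1) :> 'M[C]_N.
    by apply/matrixP => x y; rewrite !mxE.
  by rewrite tensor_power_diag big1 ?mulr1 // => s _; rewrite mxE.
rewrite tensor_powerM; apply: eq_bigr => a _; congr (_ * _).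
by rewrite /tensor_power rmorph_prod; apply: eq_bigr => s _; rewrite !mxE.
Qed.

(* The averaging operator with the Weingarten kernel fixes the commutant of the
   tensor powers: for fixed [i'] and [b] its kernel is symmetric in [(i, a)], so
   it can be moved to the other side of [A], where it reproduces the identity. *)
Lemma weingarten_reproducing (A : I -> I -> C) (f : {ffun 'S_k -> C}) :
  (forall U : 'M[C]_N, U \is unitarymx -> forall i i',
     \sum_(a : I) \sum_(b : I)
       tensor_power U i a * (tensor_power U i' b)^* * A a b = A i i') ->
  convol (convol (pow_kappa k N%:R) f) (pow_kappa k N%:R) = pow_kappa k N%:R ->
  forall i i', A i i' =
    \sum_(a : I) \sum_(b : I) weingarten_kernel f i i' a b * A a b.
Proof.
move=> Ainv fP i i'.
have AU U : U \is unitarymx -> kernel_commute A (tensor_power U).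
  (* The hypothesis says that [A] equals its conjugate by the tensor power of [U]; multiplying on
     the right by this tensor power gives the commutation. *)
  move=> Uu x y.
  under eq_bigr => b _ do rewrite -(Ainv U Uu) mulr_suml.
  rewrite exchange_big /=; apply: eq_bigr => a _.
  under eq_bigr => b _ do rewrite mulr_suml.
  rewrite exchange_big /= (bigD1 y) //= [X in _ + X]big1 ?addr0.
    transitivity (tensor_power U x a * A a y *
      \sum_b (tensor_power U b y)^* * tensor_power U b y).
      by rewrite mulr_sumr; apply: eq_bigr => b _; ring.
    by rewrite tensor_power_unitary // eqxx mulr1.
  move=> c /negPf cy.
  transitivity (tensor_power U x a * A a c *
    \sum_b (tensor_power U b c)^* * tensor_power U b y).
    by rewrite mulr_sumr; apply: eq_bigr => b _; ring.
  by rewrite tensor_power_unitary // cy mulr0.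
have AK b := commute_symmetric AU
  (B := fun c a => weingarten_kernel f c i' a b)
  (fun rho c a => weingarten_kernel_perm f rho c i' a b) i b.
rewrite [RHS]exchange_big /=.
under [RHS]eq_bigr => b _ do rewrite -AK.
rewrite exchange_big /=.
under [RHS]eq_bigr => c _ do rewrite -mulr_sumr (sum_weingarten_kernel_diag x0 fP).
rewrite (bigD1 i') //= eqxx mulr1 big1 ?addr0 // => c /negPf ->.
by rewrite mulr0.
Qed.

(** Inversion reverses convolution and fixes [G]. Using [invf] for the rows makes the Weingarten
    factor appear at [sigma1 * tau1^-1], the form required for a convolution. *)
Lemma convol_invf_pseudoinverse (f : {ffun 'S_k -> C}) (G := pow_kappa k N%:R) :
  convol (convol G f) G = G -> convol (convol G (invf f)) G = G.
Proof.
move=> GfG.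
have GV : invf G = G by apply/ffunP => pi; rewrite ffunE pow_kappaV.
by have := congr1 (@invf C k) GfG; rewrite !convol_invf GV convolA.
Qed.

End Reproducing.

(** * Rearrangement of the sums over permutations and conclusion *)

Lemma exchange_big4 (V : nmodType) (J I1 I2 I3 I4 : finType)
    (F : J -> I1 -> I2 -> I3 -> I4 -> V) :
  \sum_x \sum_a \sum_b \sum_c \sum_e F x a b c e =
  \sum_a \sum_b \sum_c \sum_e \sum_x F x a b c e.
Proof.
by do 3 (rewrite exchange_big /=; apply: eq_bigr => ? _); rewrite exchange_big.
Qed.

(** With [rho = sigma1 * tau1^-1] and [sigma2 = rho * pi^-1 * tau1], the argument of [t] becomes the
    conjugate of [pi] by [tau1], which a class function ignores, and the sum over [rho] is the
    convolution. *)
Lemma sum_weingarten_pairs (C : numClosedFieldType) (k : nat)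
    (f g : {ffun 'S_k -> C}) (t : 'S_k -> C) (tau1 tau2 : 'S_k) :
  (forall pi rho : 'S_k, t (pi ^ rho)%g = t pi) ->
  \sum_(sigma1 : 'S_k) \sum_(sigma2 : 'S_k)
     f (sigma1 * tau1^-1)%g * g (tau2 * sigma2^-1)%g * t (sigma2^-1 * sigma1)%g =
  \sum_(pi : 'S_k) convol f g (pi \oS tau1^-1%g \oS tau2) * t pi.
Proof.
move=> ct; rewrite (reindex_inj (mulIg tau1)) /=.
under [RHS]eq_bigr => pi _ do rewrite convolE mulr_suml.
rewrite [RHS]exchange_big /=; apply: eq_bigr => rho _.
have inj : injective (fun pi : 'S_k => rho * pi^-1 * tau1)%g.
  by move=> x y /mulIg /mulgI /invg_inj.
rewrite (reindex_inj inj) /=; apply: eq_bigr => pi _.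
rewrite mulgK !invMg invgK -(ct pi tau1) conjgE /perm_comp.
by rewrite !mulgA !(mulgKV rho).
Qed.

Theorem theorem3p4 (R : realType) (d : measure_display) (T : measurableType d)
    (P : probability T R) (n p k : nat)
    (n_ge1 : (1 <= n)%N) (p_ge1 : (1 <= p)%N) (k_ge1 : (1 <= k)%N)
    (X : T -> 'M[R[i]]_(n, p))
    (X_random : random_matrix X)
    (X_invariant : forall (U : 'M[R[i]]_n) (V : 'M[R[i]]_p),
       U \is unitarymx -> V \is unitarymx ->
       same_distribution P X (fun t => U *m X t *m V))
    (X_moments : forall pi : 'S_k,
       complex_integrable P (fun t => Tr_perm pi (X t *m (X t)^t*)))
    (i i' : 'I_n ^ k) (j j' : 'I_p ^ k) :
  complex_expectation P (fun t =>
      (\prod_(s < k) X t (i s) (j s)) *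
      Num.conj (\prod_(s < k) X t (i' s) (j' s))) =
  \sum_(sigma1 : 'S_k) \sum_(sigma2 : 'S_k) \sum_(pi : 'S_k)
    delta_perm R[i] sigma1 i i' * delta_perm R[i] sigma2 j j' *
    WgU2 k n%:R p%:R (pi \oS (sigma1^-1)%g \oS sigma2) *
    complex_expectation P (fun t => Tr_perm pi (X t *m (X t)^t*)).
Proof.
pose x0 : 'I_n := Ordinal n_ge1; pose y0 : 'I_p := Ordinal p_ge1.
have [_ Wn _] := WgUP R[i] k x0; have [_ Wp _] := WgUP R[i] k y0.
set wn := WgU k n%:R in Wn; set wp := WgU k p%:R in Wp.
pose M := moment (k := k) P X.
pose t (pi : 'S_k) : R[i] :=
  complex_expectation P (fun t => Tr_perm pi (X t *m (X t)^t*)).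
have ct pi rho : t (pi ^ rho)%g = t pi.
  congr (complex_expectation P _); apply/funext => u.
  by rewrite (Tr_perm_class x0).
(* The reproducing property is applied first to the row indices, then to the column indices of each
   resulting moment. *)
transitivity (\sum_a \sum_b \sum_c \sum_e
   weingarten_kernel (invf wn) i i' a b * (weingarten_kernel wp j j' c e * M a b c e)).
  transitivity (\sum_a \sum_b weingarten_kernel (invf wn) i i' a b * M a b j j').
    apply: (weingarten_reproducing x0 (A := fun a b => M a b j j')).
      by move=> U Uu a b; apply: (moment_row_invariant x0).
    exact: convol_invf_pseudoinverse.
  apply: eq_bigr => a _; apply: eq_bigr => b _.
  rewrite [M a b j j'](weingarten_reproducing y0 (A := M a b) (f := wp)) //.
    by rewrite mulr_sumr; apply: eq_bigr => c _; rewrite mulr_sumr.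
  by move=> U Uu c e; apply: (moment_col_invariant x0).
transitivity (\sum_(tau1 : 'S_k) \sum_(tau2 : 'S_k)
   delta_perm R[i] tau1 i i' * delta_perm R[i] tau2 j j' *
   \sum_(sigma1 : 'S_k) \sum_(sigma2 : 'S_k)
     wn (sigma1 * tau1^-1)%g * wp (tau2 * sigma2^-1)%g * t (sigma2^-1 * sigma1)%g);
  last first.
  apply: eq_bigr => tau1 _; apply: eq_bigr => tau2 _.
  rewrite (sum_weingarten_pairs _ _ _ _ ct) mulr_sumr.
  by apply: eq_bigr => pi _; rewrite mulrA.
transitivity (\sum_(tau1 : 'S_k) \sum_(tau2 : 'S_k) \sum_(sigma1 : 'S_k) \sum_(sigma2 : 'S_k)
   \sum_a \sum_b \sum_c \sum_e
    delta_perm R[i] tau1 i i' * delta_perm R[i] tau2 j j' *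
    (wn (sigma1 * tau1^-1)%g * wp (tau2 * sigma2^-1)%g) *
    (delta_perm R[i] sigma1 a b * delta_perm R[i] sigma2 c e * M a b c e)); last first.
  apply: eq_bigr => tau1 _; apply: eq_bigr => tau2 _; rewrite mulr_sumr.
  apply: eq_bigr => sigma1 _; rewrite mulr_sumr; apply: eq_bigr => sigma2 _.
  rewrite -[t _](moment_Tr_perm x0 X_random X_moments) !mulrA mulr_sumr.
  do 3 (apply: eq_bigr => ? _; rewrite mulr_sumr).
  by apply: eq_bigr => e _; rewrite !mulrA.
(* Starting from the innermost, each sum over permutations is moved inside the four sums over
   indices. *)
under [RHS]eq_bigr => tau1 _ do under eq_bigr => tau2 _ do
  under eq_bigr => sigma1 _ do rewrite exchange_big4.
under [RHS]eq_bigr => tau1 _ do under eq_bigr => tau2 _ do rewrite exchange_big4.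
under [RHS]eq_bigr => tau1 _ do rewrite exchange_big4.
rewrite exchange_big4.
apply: eq_bigr => a _; apply: eq_bigr => b _.
apply: eq_bigr => c _; apply: eq_bigr => e _.
rewrite /weingarten_kernel exchange_big mulr_suml; apply: eq_bigr => tau1 _ /=.
rewrite mulr_suml [RHS]exchange_big; apply: eq_bigr => sigma1 _ /=.
rewrite exchange_big mulr_suml mulr_sumr; apply: eq_bigr => tau2 _ /=.
rewrite mulr_suml mulr_sumr; apply: eq_bigr => sigma2 _.
by rewrite ffunE invMg invgK; ring.
Qed.
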